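(* Let $r\ge2$ and $2\le s\le r$ be integers. There exist $\delta_0>0$ and $n_0$ such that for all $n\ge n_0$ and $0<\delta\le\delta_0$ the following holds: if $G$ is a graph on $n$ vertices containing no copy of $K_{r+1}$ and $k_s(G)\ge\binom rs\left(\frac nr\right)^s-\delta n^s$, then $$D_r(G)\le\left(\frac{2r}{3\sqrt3}+o_\delta(1)\right)\frac{\binom r2^{3/2}}{\binom rs^{3/s}}\,\delta^{3/s}n^2,$$ where $o_\delta(1)$ denotes a term (depending only on $r,s,\delta$) that tends to $0$ as $\delta\to0$.
   Context: $K_{m}$ is the complete graph on $m$ vertices; $k_s(G)$ is the number of copies of $K_s$ in $G$. $D_r(G)$ is the minimum number of edges that must be removed from $G$ to make it $r$-partite (i.e. $r$-colorable). *)

(* Defs.v *)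
From Stdlib Require Import Reals.
From mathcomp Require Import all_boot.

Set Implicit Arguments.
Unset Strict Implicit.
Unset Printing Implicit Defensive.

Definition is_graph (n : nat) (e : rel 'I_n) : Prop :=
  symmetric e /\ irreflexive e.

Definition is_clique (n : nat) (e : rel 'I_n) (A : {set 'I_n}) : bool :=
  [forall x in A, forall y in A, (x != y) ==> e x y].

Definition kcount (n : nat) (e : rel 'I_n) (s : nat) : nat :=
  #|[set A : {set 'I_n} | is_clique e A & #|A| == s]|.

Definition mono_edges (n r : nat) (e : rel 'I_n) (f : {ffun 'I_n -> 'I_r}) : nat :=
  #|[set p : 'I_n * 'I_n | [&& (p.1 < p.2)%N, e p.1 p.2 & f p.1 == f p.2]]|.

Definition nedges (n : nat) (e : rel 'I_n) : nat :=
  #|[set p : 'I_n * 'I_n | (p.1 < p.2)%N && e p.1 p.2]|.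

(* D_r(G): minimum number of edges whose removal makes G r-partite,
   i.e. the minimum over r-colourings of the number of monochromatic edges.
   (The seed nedges e is an upper bound of every term, so it does not affect
   the minimum whenever a colouring exists, e.g. r >= 1.) *)
Definition Dr (r n : nat) (e : rel 'I_n) : nat :=
  \big[minn/nedges e]_(f : {ffun 'I_n -> 'I_r}) mono_edges e f.

(* Main.v *)
Require Import Defs.
From Stdlib Require Import Reals ZArith Lra Psatz.
From mathcomp Require Import all_boot zify.

(** Iterating Moon and Moser's inequality down from [k_(r+1) = 0] bounds [k_s]
    linearly in terms of [k_2], so the hypothesis gives
    [k_2 >= (1 - 1/r) n^2 / 2 - alpha n^2] with
    [alpha = C(r,2) (d / C(r,s))^(2/s)].

    Fix an [r]-colouring with the fewest monochromatic edges.  By Füredi's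
    argument there are at most [alpha n^2] of them, so the classes have size
    about [n / r], and at most [(alpha + o(alpha)) n^2] bichromatic pairs are
    non-adjacent ("missing").  If [v w] is a monochromatic edge, its common
    neighbourhoods contain no [K_(r-1)], so some class contains few common
    neighbours, and [v] and [w] together lie in about [n / r] missing pairs.
    Hence, up to lower order, every monochromatic edge has an endpoint in the
    set [A] of vertices lying in about [n / r] missing pairs, and their number
    is at most [#|A| * x n], where [x n] is the maximal monochromatic degree.
    A vertex of monochromatic degree [x n] has, by minimality, [x n] neighbours
    in every class; these contain no [K_r], which forces [x^2 n^2] missing pairs,
    almost all disjoint from [A].  So [#|A| <= r (alpha - x^2) n] up to lower
    order, and the cubic [r x (alpha - x^2)] is at most
    [2 r / (3 sqrt 3) * alpha^(3/2)].

    The error terms are polynomial in [bt = alpha^(1/8)]; the threshold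
    separating negligible missing degrees is [bt * n]. *)

Set Implicit Arguments.
Unset Strict Implicit.
Unset Printing Implicit Defensive.

(** * Clique counts *)

Lemma cauchy_schwarz_nat (I : finType) (P : pred I) (F : I -> nat) :
  ((\sum_(i | P i) F i) ^ 2 <= #|P| * \sum_(i | P i) F i ^ 2)%N.
Proof.
have -> : ((\sum_(i | P i) F i) ^ 2 = \sum_(i | P i) \sum_(j | P j) F i * F j)%N.
  by rewrite -mulnn big_distrl /=; apply: eq_bigr => i _; rewrite big_distrr.
rewrite -(leq_pmul2l (isT : 0 < 2)%N).
have -> : (2 * (#|P| * \sum_(i | P i) F i ^ 2)
  = \sum_(i | P i) \sum_(j | P j) (F i ^ 2 + F j ^ 2))%N.
  rewrite [RHS](eq_bigr (fun i => #|P| * F i ^ 2 + \sum_(j | P j) F j ^ 2)%N).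
    by rewrite big_split /= sum_nat_const -big_distrr /= mul2n addnn.
  by move=> i _; rewrite big_split /= sum_nat_const.
rewrite big_distrr; apply: leq_sum => i _ /=.
by rewrite big_distrr; apply: leq_sum => j _; exact: nat_Cauchy.
Qed.

Section CliqueCounts.
Variables (n : nat) (e : rel 'I_n).
Hypothesis ge : is_graph e.

Lemma cliqueP (A : {set 'I_n}) :
  reflect {in A &, forall x y, x != y -> e x y} (is_clique e A).
Proof.
apply: (iffP forall_inP) => [H x y Ax Ay xy|H x Ax].
  by have /forall_inP/(_ y Ay)/implyP/(_ xy) := H x Ax.
by apply/forall_inP => y Ay; apply/implyP; apply: H.
Qed.

Lemma clique_sub (A B : {set 'I_n}) :
  A \subset B -> is_clique e B -> is_clique e A.
Proof.
move=> /subsetP AB /cliqueP cB; apply/cliqueP => x y Ax Ay.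
by apply: cB; apply: AB.
Qed.

Definition extends (A : {set 'I_n}) (v : 'I_n) : bool := [forall x in A, e v x].

Lemma extends_notin (A : {set 'I_n}) v : extends A v -> v \notin A.
Proof.
case: ge => _ ie /forall_inP H; apply/negP => /H; by rewrite ie.
Qed.

Lemma clique_setU1 (A : {set 'I_n}) v :
  v \notin A -> is_clique e (v |: A) = is_clique e A && extends A v.
Proof.
case: ge => se ie vA; apply/idP/andP => [cA|[/cliqueP cA /forall_inP vx]].
  split; first exact: clique_sub (subsetUr _ _) cA.
  apply/forall_inP => x Ax; move/cliqueP: cA; apply.
  - by rewrite setU11.
  - by rewrite setU1r.
  by apply: contraNneq vA => ->.
apply/cliqueP => x y /setU1P[->|Ax] /setU1P[->|Ay]; rewrite ?eqxx //.
- by move=> _; apply: vx.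
- by move=> _; rewrite se; apply: vx.
- exact: cA.
Qed.

Definition cliques (s : nat) : {set {set 'I_n}} :=
  [set A : {set 'I_n} | is_clique e A & #|A| == s].

Definition ext_deg (A : {set 'I_n}) : nat := #|extends A|.

(** Double counting: an [s]-clique [A] with an extending vertex [v] is the same as the larger clique
    [v |: A] with [v] marked. *)
Lemma sum_extensions s (F : {set 'I_n} -> 'I_n -> nat) :
  (\sum_(A in cliques s) \sum_(v | extends A v) F A v
   = \sum_(Q in cliques s.+1) \sum_(v in Q) F (Q :\ v) v)%N.
Proof.
rewrite !pair_big_dep /=.
rewrite (reindex_onto (fun p : {set 'I_n} * 'I_n => (p.1 :\ p.2, p.2))
                      (fun p => (p.2 |: p.1, p.2))) /=; last first.
  move=> [A v] /= /andP[_ /extends_notin vA]; by rewrite setU1K.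
apply: eq_bigl => -[Q v] /=; rewrite !inE.
apply/idP/idP.
  case/andP=> /andP[/andP[cA /eqP sA] ex] /eqP[<-].
  rewrite setU11 andbT cardsU1 sA.
  by rewrite (extends_notin ex) clique_setU1 ?extends_notin // cA ex eqxx.
case/andP=> /andP[cQ /eqP sQ] vQ.
have E := setD1K vQ; rewrite E eqxx andbT.
have vD : v \notin Q :\ v by rewrite !inE eqxx.
move: (cQ); rewrite -{1}E clique_setU1 // => /andP[-> ->]; rewrite andbT /=.
by have := cardsD1 v Q; rewrite vQ sQ add1n => -[->].
Qed.

Lemma sum_ext_deg s : (\sum_(A in cliques s) ext_deg A = s.+1 * kcount e s.+1)%N.
Proof.
have := sum_extensions s (fun _ _ => 1%N).
under eq_bigr => A _ do rewrite sum1_card.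
move=> ->.
rewrite (eq_bigr (fun=> s.+1)); first by rewrite sum_nat_const mulnC.
by move=> Q; rewrite inE sum1_card => /andP[_ /eqP].
Qed.

(* A vertex is adjacent to all of [Q :\ v] for every [v] if it extends [Q],
   and for at most one [v] otherwise. *)
Lemma sum_ext_deg_facets s (Q : {set 'I_n}) : #|Q| = s.+1 ->
  (\sum_(v in Q) ext_deg (Q :\ v) <= n + s * ext_deg Q)%N.
Proof.
move=> sQ.
have -> : (n + s * ext_deg Q = \sum_(w : 'I_n) (1 + s * extends Q w))%N.
  rewrite big_split /= sum1_card card_ord -big_distrr /=.
  by rewrite /ext_deg -sum1_card big_mkcond.
have -> : (\sum_(v in Q) ext_deg (Q :\ v)
           = \sum_(w : 'I_n) \sum_(v in Q) extends (Q :\ v) w)%N.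
  rewrite exchange_big /=; apply: eq_bigr => v _.
  by rewrite /ext_deg -sum1_card big_mkcond.
apply: leq_sum => w _; case: (boolP (extends Q w)) => [_|nQ].
  rewrite -(addn0 1) addn0 muln1 add1n -sQ -sum1_card; apply: leq_sum => v _.
  exact: leq_b1.
rewrite muln0 addn0.
have [x xQ nwx] : exists2 x, x \in Q & ~~ e w x.
  by move: nQ; rewrite negb_forall_in => /exists_inP.
rewrite (bigD1 x) //= big1 ?addn0 ?leq_b1 // => v /andP[vQ vx].
apply/eqP; rewrite eqb0; apply: contra nwx => /forall_inP; apply.
by rewrite !inE eq_sym vx.
Qed.

(** Cauchy-Schwarz for [ext_deg] over the [s]-cliques. By double counting, the sum of squares
    becomes a sum over the facets of the next larger cliques, which [sum_ext_deg_facets] bounds. *)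
Lemma moon_moser s :
  ((s.+1 * kcount e s.+1) ^ 2
   <= kcount e s * (n * kcount e s.+1 + s * (s.+2 * kcount e s.+2)))%N.
Proof.
rewrite -sum_ext_deg; apply: leq_trans (cauchy_schwarz_nat _ _) _.
have -> : #|mem (cliques s)| = kcount e s by [].
rewrite leq_mul2l; apply/orP; right.
have -> : (\sum_(A in cliques s) ext_deg A ^ 2
   = \sum_(A in cliques s) \sum_(v | extends A v) ext_deg A)%N.
  by apply: eq_bigr => A _; rewrite sum_nat_const mulnn.
rewrite (sum_extensions s (fun A _ => ext_deg A)) -sum_ext_deg.
have -> : (n * kcount e s.+1 + s * (\sum_(A in cliques s.+1) ext_deg A)
  = \sum_(A in cliques s.+1) (n + s * ext_deg A))%N.
  by rewrite big_split /= sum_nat_const big_distrr /= [(kcount _ _ * _)%N]mulnC.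
apply: leq_sum => Q; rewrite inE => /andP[_ /eqP sQ].
exact: sum_ext_deg_facets.
Qed.

(** Downward induction from [s = r], where the left side vanishes: once the induction hypothesis
    bounds the last term of [moon_moser], one factor [s.+1 * kcount e s.+1] cancels. Balanced
    complete [r]-partite graphs give equality. *)
Lemma kcount_ratio r s : kcount e r.+1 = 0%N -> (s <= r)%N ->
  (r * (s.+1 * kcount e s.+1) <= (r - s) * n * kcount e s)%N.
Proof.
move=> k0 sr; rewrite -(subKn sr).
elim: (r - s)%N (leq_subr s r) => [|i IH] ir; first by rewrite subn0 k0 !muln0.
have {IH} := IH (ltnW ir).
have -> : (r - i = (r - i.+1).+1)%N by lia.
have := moon_moser (r - i.+1).
have -> : (r - (r - i.+1).+1 = i)%N by lia.
have -> : (r - (r - i.+1) = i.+1)%N by lia.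
have : (r = (r - i.+1) + i.+1)%N by lia.
move: (r - i.+1)%N => t rt.
move: (kcount e t) (kcount e t.+1) (kcount e t.+2) => k k1 k2 MM IH.
case: (posnP k1) => [->|k1p]; first by rewrite !muln0.
have H : (t.+1 * k1 * (r * (t.+1 * k1)) <= t.+1 * k1 * (i.+1 * n * k))%N.
  have -> : (t.+1 * k1 * (r * (t.+1 * k1)) = r * (t.+1 * k1) ^ 2)%N by nia.
  apply: leq_trans (leq_mul (leqnn r) MM) _.
  have -> : (r * (k * (n * k1 + t * (t.+2 * k2)))
    = k * (r * n * k1) + k * t * (r * (t.+2 * k2)))%N by nia.
  apply: leq_trans (leq_add (leqnn _) (leq_mul (leqnn (k * t)) IH)) _.
  by rewrite rt; apply: eq_leq; nia.
by move: H; rewrite leq_pmul2l // muln_gt0 k1p.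
Qed.

(** Telescoping product of the ratios in [kcount_ratio], with denominators cleared. *)
Lemma kcount_le_kcount2 r s : kcount e r.+1 = 0%N -> (s.+2 <= r)%N ->
  (kcount e s.+2 * r ^ s * 'C(r, 2) <= kcount e 2 * n ^ s * 'C(r, s.+2))%N.
Proof.
move=> k0; elim: s => [|s IH] sr; first by rewrite !expn0 !muln1.
have H := kcount_ratio k0 (ltnW sr); have {}IH := IH (ltnW sr).
have B := mul_bin_left r s.+2.
rewrite -(leq_pmul2l (isT : 0 < s.+3)%N).
have -> : (s.+3 * (kcount e s.+3 * r ^ s.+1 * 'C(r, 2))
  = r * (s.+3 * kcount e s.+3) * (r ^ s * 'C(r, 2)))%N by rewrite expnS; nia.
apply: leq_trans (leq_mul H (leqnn _)) _.
have -> : ((r - s.+2) * n * kcount e s.+2 * (r ^ s * 'C(r, 2))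
  = (r - s.+2) * n * (kcount e s.+2 * r ^ s * 'C(r, 2)))%N by nia.
apply: leq_trans (leq_mul (leqnn _) IH) _.
have -> : (s.+3 * (kcount e 2 * n ^ s.+1 * 'C(r, s.+3))
  = s.+3 * 'C(r, s.+3) * (kcount e 2 * n ^ s.+1))%N by nia.
by rewrite B expnS; apply: eq_leq; nia.
Qed.

Lemma kcount2_double : (\sum_x \sum_y e x y = 2 * kcount e 2)%N.
Proof.
rewrite -sum_ext_deg.
have -> : cliques 1 = [set [set x] | x : 'I_n].
  apply/setP => A; rewrite !inE; apply/andP/imsetP.
    by case=> _ /cards1P[x ->]; exists x.
  case=> x _ ->; rewrite cards1 eqxx; split=> //.
  by apply/cliqueP => y z /set1P-> /set1P->; rewrite eqxx.
rewrite big_imset /=; last by move=> x y _ _ /set1_inj.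
apply: eq_big => // x _; rewrite /ext_deg -sum1_card [RHS]big_mkcond /=.
apply: eq_bigr => y _; rewrite -[y \in _]/(extends [set x] y).
case: ge => se _; rewrite se.
have -> : extends [set x] y = e y x.
  apply/forall_inP/idP => [H|H z /set1P-> //]; apply: H; exact: set11.
by case: (e y x).
Qed.

End CliqueCounts.

(** * Füredi's stability argument and transversals *)

Lemma sum_setT2 (T : finType) (g : T -> T -> nat) :
  (\sum_(x in setT) \sum_(y in setT) g x y = \sum_x \sum_y g x y)%N.
Proof.
by apply: eq_big => [x|x _]; rewrite ?inE //; apply: eq_bigl => y; rewrite inE.
Qed.

(** By symmetry the block of pairs from [A'] to [A :\: A'] is transposed, so that everything beyond
    the square of [A'] is charged to vertices outside [A']. *)
Lemma sum_sym_split (T : finType) (g : T -> T -> nat) (A A' : {set T}) :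
  (forall x y, g x y = g y x) -> A' \subset A ->
  (\sum_(x in A) \sum_(y in A) g x y = \sum_(x in A') \sum_(y in A') g x y
   + \sum_(x in A :\: A') (\sum_(y in A') g x y + \sum_(y in A) g x y))%N.
Proof.
move=> sg sA.
have S (F : T -> nat) :
  (\sum_(x in A) F x = \sum_(x in A') F x + \sum_(x in A :\: A') F x)%N.
  by rewrite (big_setID A') /= (setIidPr sA).
rewrite S big_split /= addnA; congr (_ + _)%N.
under eq_bigr => x _ do rewrite S.
rewrite big_split /=; congr (_ + _)%N.
by rewrite exchange_big; apply: eq_bigr => x _; apply: eq_bigr => y _.
Qed.

Section Graph.
Variables (n : nat) (e : rel 'I_n).
Hypothesis ge : is_graph e.

(* Füredi's stability argument: split off the non-neighbours of a vertex of
   maximum degree and recurse into its neighbourhood. *)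
Lemma furedi_on r (A : {set 'I_n}) :
  (forall B : {set 'I_n}, B \subset A -> is_clique e B -> #|B| != r.+1) ->
  exists f : 'I_n -> nat, (forall x, x \in A -> (f x < r)%N) /\
    (\sum_(x in A) \sum_(y in A) e x y
     + \sum_(x in A) \sum_(y in A) (e x y && (f x == f y))
     <= \sum_(x in A) \sum_(y in A) (f x != f y))%N.
Proof.
have [se ie] := ge.
elim: r A => [|r IH] A nK.
  have A0 : A = set0.
    apply/setP => x; rewrite inE; apply/negP => Ax.
    have /negP[] : #|[set x]| != 1%N by
      apply: nK; [rewrite sub1set|apply/cliqueP => y z /set1P-> /set1P->; rewrite eqxx].
    by rewrite cards1.
  exists (fun=> 0%N); split=> [x|]; first by rewrite A0 inE.
  by rewrite A0 !big_set0.
have [A0|[x0 x0A]] := set_0Vmem A.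
  exists (fun=> 0%N); split=> [x|]; first by rewrite A0 inE.
  by rewrite A0 !big_set0.
pose dg x := (\sum_(y in A) e x y)%N.
have [x xA xmax] : exists2 x, x \in A & forall y, y \in A -> (dg y <= dg x)%N.
  by case: (@arg_maxnP _ x0 (mem A) dg x0A) => x xA xm; exists x.
pose A' := [set y in A | e x y].
have sA : A' \subset A by apply/subsetP => y; rewrite inE => /andP[].
have cA' : #|A'| = dg x.
  rewrite /dg -sum1_card big_mkcond [RHS]big_mkcond; apply: eq_bigr => y _.
  by rewrite inE; case: (y \in A).
have [f [fr fF]] : exists f : 'I_n -> nat, (forall x, x \in A' -> (f x < r)%N) /\
    (\sum_(x in A') \sum_(y in A') e x y
     + \sum_(x in A') \sum_(y in A') (e x y && (f x == f y))
     <= \sum_(x in A') \sum_(y in A') (f x != f y))%N.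
  apply: IH => B BA' cB.
  have xB : x \notin B.
    by apply/negP => /(subsetP BA'); rewrite inE ie andbF.
  have /nK : x |: B \subset A by rewrite subUset sub1set xA (subset_trans BA').
  rewrite clique_setU1 // cB cardsU1 xB; apply.
  by apply/forall_inP => y /(subsetP BA'); rewrite inE => /andP[].
(* On the neighbourhood [A'] the colours are below [r], so [r] is a fresh colour for the rest of
   [A]. *)
pose h y := if y \in A' then f y else r.
exists h; split=> [y _|].
  by rewrite /h; case: ifP => [/fr/ltnW|].
rewrite (sum_sym_split _ sA); last by move=> y z; rewrite se.
rewrite (sum_sym_split (g := fun x y => nat_of_bool (e x y && (h x == h y))) _ sA);
  last by move=> y z; rewrite se eq_sym.
rewrite (sum_sym_split (g := fun x y => nat_of_bool (h x != h y)) _ sA);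
  last by move=> y z; rewrite eq_sym.
have hf y : y \in A' -> h y = f y by rewrite /h => ->.
have -> : (\sum_(x in A') \sum_(y in A') (e x y && (h x == h y))
    = \sum_(x in A') \sum_(y in A') (e x y && (f x == f y)))%N.
  by apply: eq_bigr => y yA; apply: eq_bigr => z zA; rewrite !hf.
rewrite [leqRHS](_ : _ = (\sum_(x in A') \sum_(y in A') (f x != f y)
  + \sum_(x in A :\: A') (#|A'| + #|A'|))%N); last first.
  congr (_ + _)%N.
    by apply: eq_bigr => y yA; apply: eq_bigr => z zA; rewrite !hf.
  apply: eq_bigr => y; rewrite inE => /andP[/negPf yA' _].
  have hne z : nat_of_bool (h y != h z) = (z \in A').
    rewrite /h yA'; case: ifP => [/fr|]; last by rewrite eqxx.
    by rewrite ltn_neqAle eq_sym => /andP[->].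
  have E : (\sum_(z in A') (h y != h z) = #|A'|)%N.
    by rewrite -sum1_card; apply: eq_bigr => z zA; rewrite hne zA.
  rewrite E (big_setID A') /= (setIidPr sA) E big1 ?addn0 //.
  by move=> z; rewrite inE hne => /andP[/negPf-> _].
rewrite addnACA; apply: leq_add => //; rewrite -big_split /=.
apply: leq_sum => y; rewrite inE => /andP[/negPf yA' yA].
have E1 : (\sum_(z in A') (e y z && (h y == h z)) = 0)%N.
  apply: big1 => z zA; rewrite {1}/h yA' hf // gtn_eqF ?andbF //; exact: fr.
have E2 : (\sum_(z in A) (e y z && (h y == h z))
           <= \sum_(z in A :\: A') e y z)%N.
  rewrite (big_setID A') /= (setIidPr sA) E1 add0n; apply: leq_sum => z _.
  by case: (e y z); rewrite ?leq_b1.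
(* Both summands are at most the maximum degree [#|A'|]: the monochromatic neighbours of [y] lie
   outside [A'], so together with its neighbours in [A'] they number at most the degree of [y]. *)
rewrite E1 add0n addnAC; apply: leq_add; last by rewrite cA'; apply: xmax.
rewrite cA'; apply: leq_trans (xmax y yA).
by rewrite /dg [leqRHS](big_setID A') /= (setIidPr sA) leq_add2l.
Qed.

End Graph.

(* Averaging: a missing pair between [N j] and [N k] spoils a proportion
   [1 / (g * g)] of the transversals, and each transversal is spoilt at least
   twice, once for each orientation. *)
Lemma transversal_missing (T I : finType) (e : rel T) (N : I -> {set T}) (g : nat) :
  symmetric e -> (forall j, (g <= #|N j|)%N) ->
  (forall p : {ffun I -> T}, (forall j, p j \in N j) ->
     exists j k, j != k /\ ~~ e (p j) (p k)) ->
  (2 * g ^ 2 <= \sum_j \sum_(k | j != k) \sum_(x in N j) \sum_(y in N k) ~~ e x y)%N.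
Proof.
move=> se gN bad.
(* Shrinking every set to exactly [g] elements makes the counts of transversals exact. *)
have {gN} [N' sN cN] : exists2 N' : I -> {set T},
    (forall j, N' j \subset N j) & forall j, #|N' j| = g.
  have H j : exists B : {set T}, (B \subset N j) && (#|B| == g).
    move: (gN j); rewrite -bin_gt0 -cards_draws => /card_gt0P[B].
    by rewrite inE => BN; exists B.
  exists (fun j => xchoose (H j)) => j; have := xchooseP (H j); first by case/andP.
  by case/andP=> _ /eqP.
apply: leq_trans (_ : (\sum_j \sum_(k | j != k)
    \sum_(x in N' j) \sum_(y in N' k) ~~ e x y <= _)%N); last first.
  apply: leq_sum => j _; apply: leq_sum => k _.
  rewrite [leqRHS](big_setID (N' j)) /= (setIidPr (sN j)).
  apply: leq_trans (leq_addr _ _); apply: leq_sum => x _.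
  by rewrite [leqRHS](big_setID (N' k)) /= (setIidPr (sN k)) leq_addr.
case: (posnP g) => [-> //|gp].
have {}bad (p : {ffun I -> T}) : (forall j, p j \in N' j) -> exists j k, j != k /\ ~~ e (p j) (p k).
  by move=> H; apply: bad => j; apply: (subsetP (sN j)).
pose F := family (fun j => mem (N' j)).
have cF : #|F| = (g ^ #|I|)%N.
  rewrite card_family foldrE big_map big_enum /=.
  by rewrite (eq_bigr (fun=> g)) ?prod_nat_const //= => j _.
have two (p : {ffun I -> T}) : p \in F -> (2 <= \sum_j \sum_(k | j != k) ~~ e (p j) (p k))%N.
  move=> /familyP pF; have [j [k [jk ne]]] := bad p pF.
  have le1 (P : pred I) (G : I -> nat) i : P i -> (G i <= \sum_(i | P i) G i)%N.
    by move=> Pi; rewrite (bigD1 i) //= leq_addr.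
  have kj : k != j by rewrite eq_sym.
  rewrite (bigD1 j) //= (leq_add (m1 := 1) (m2 := 1)) //.
    by apply: leq_trans (le1 _ _ k jk); rewrite ne.
  apply: leq_trans (le1 _ _ k kj).
  by apply: leq_trans (le1 (fun i => k != i) _ j kj); rewrite se ne.
(* Two prescribed points leave [g ^ (#|I| - 2)] transversals; the factor [g ^ 2] avoids the
   subtraction. *)
have ext j k x y : j != k -> x \in N' j -> y \in N' k ->
    (#|[pred p in F | (p j == x) && (p k == y)]| * g ^ 2 = g ^ #|I|)%N.
  move=> jk xN yN.
  pose G i := if i == j then pred1 x else if i == k then pred1 y else mem (N' i).
  have -> : #|[pred p in F | (p j == x) && (p k == y)]| = #|family G|.
    apply: eq_card => p; rewrite !inE; apply/idP/idP.
      case/andP=> /familyP pF /andP[/eqP px /eqP py]; apply/familyP => i.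
      rewrite /G; case: eqP => [->|_]; first by rewrite inE px.
      case: eqP => [->|_]; [by rewrite inE py|exact: pF].
    move=> /familyP pG; have := pG j; have := pG k.
    rewrite /G eqxx (negPf (_ : k != j)) 1?eq_sym // eqxx !inE => /eqP py /eqP px.
    rewrite px py !eqxx !andbT; apply/familyP => i.
    have := pG i; rewrite /G; case: eqP => [->|_]; first by rewrite inE => /eqP->.
    by case: eqP => [->|//]; rewrite inE => /eqP->.
  rewrite card_family foldrE big_map big_enum /=.
  rewrite (bigD1 j) //= (bigD1 k) 1?eq_sym //= /G eqxx (negPf (_ : k != j)) 1?eq_sym //.
  rewrite eqxx !card1 !mul1n.
  have -> : (g ^ #|I| = \prod_(i : I) g)%N by rewrite prod_nat_const.
  rewrite [RHS](bigD1 j) //= [X in _ = (_ * X)%N](bigD1 k) 1?eq_sym //=.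
  rewrite (eq_bigr (fun=> g)) => [|i /andP[ij ik]]; last first.
    by rewrite (negPf ij) (negPf ik) -[RHS](cN i); apply: eq_card.
  by rewrite mulnC -mulnn -mulnA.
set M := (X in (_ <= X)%N).
suff H : (g ^ #|I| * 2 * g ^ 2 <= M * g ^ #|I|)%N.
  by rewrite -(leq_pmul2r (_ : 0 < g ^ #|I|)%N) ?expn_gt0 ?gp // mulnC mulnA.
apply: leq_trans (_ : ((\sum_(p in F)
   \sum_j \sum_(k | j != k) ~~ e (p j) (p k)) * g ^ 2 <= _)%N).
  rewrite leq_mul2r; apply/orP; right.
  by rewrite -cF -sum_nat_const; apply: leq_sum => p; apply: two.
rewrite exchange_big /= /M !big_distrl /=; apply: leq_sum => j _.
rewrite exchange_big /= !big_distrl /=; apply: leq_sum => k jk.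
have -> : (\sum_(p in F) ~~ e (p j) (p k) = \sum_(p in F)
   \sum_(x in N' j) \sum_(y in N' k) ~~ e x y * ((p j == x) && (p k == y)))%N.
  apply: eq_bigr => p /familyP pF.
  rewrite (bigD1 (p j)) ?pF //= (bigD1 (p k)) ?pF //= !eqxx muln1.
  rewrite big1 => [|y /andP[_ /negPf]]; last by rewrite eq_sym => ->; rewrite andbF muln0.
  rewrite big1 => [|x /andP[_ /negPf]]; first by rewrite !addn0.
  by rewrite eq_sym => xp; apply: big1 => y _; rewrite xp muln0.
rewrite exchange_big /= !big_distrl /=; apply: leq_sum => x xN.
rewrite exchange_big /= !big_distrl /=; apply: leq_sum => y yN.
rewrite -big_distrr /= -mulnA leq_mul2l; apply/orP; right.
rewrite -(ext j k x y) // leq_mul2r; apply/orP; right.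
rewrite -sum1_card big_mkcond [leqRHS]big_mkcond /=; apply: leq_sum => p _.
rewrite -[X in if X then 1%N else 0%N]/((p \in F) && ((p j == x) && (p k == y))).
by case: (p \in F); case: (_ && _).
Qed.

(** * Missing pairs of a colouring *)

Lemma sum_disjoint_le (T I : finType) (N : I -> {set T}) (S : {set T}) (F : T -> nat) :
  (forall j k x, x \in N j -> x \in N k -> j = k) -> (forall j, N j \subset S) ->
  (\sum_j \sum_(x in N j) F x <= \sum_(x in S) F x)%N.
Proof.
move=> dN sN; rewrite (exchange_big_dep (mem S)) /=; last first.
  by move=> j x _; apply: (subsetP (sN j)).
apply: leq_sum => x xS.
case: (pickP (fun j => x \in N j)) => [j xj|no]; last by rewrite big_pred0.
by rewrite (big_pred1 j) // => k; apply/idP/eqP => [|->//] xk; apply: dN xk xj.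
Qed.

Lemma sum_mem_indicator (T : finType) (A : {set T}) (F : T -> nat) :
  (\sum_(x in A) F x = \sum_x (x \in A) * F x)%N.
Proof.
by rewrite big_mkcond; apply: eq_bigr => x _; case: (x \in A); rewrite ?mul1n.
Qed.

Section Colouring.
Variables (n r : nat) (e : rel 'I_n).
Hypothesis ge : is_graph e.

Lemma transversal_clique (I : finType) (p : I -> 'I_n) :
  (forall j k, j != k -> e (p j) (p k)) ->
  is_clique e [set p j | j : I] /\ #|[set p j | j : I]| = #|I|.
Proof.
case: ge => se ie H; split; last first.
  rewrite card_imset // => j k E; apply/eqP; apply: contraFT (ie (p j)) => /H.
  by rewrite E.
apply/cliqueP => _ _ /imsetP[j _ ->] /imsetP[k _ ->] jk; apply: H.
by apply: contra_neq jk => ->.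
Qed.

Lemma kcount0_clique s (A : {set 'I_n}) :
  kcount e s = 0%N -> is_clique e A -> #|A| != s.
Proof.
move=> /eqP; rewrite cards_eq0 => /eqP k0 cA; apply/negP => sA.
by have := in_set0 A; rewrite -k0 inE cA sA.
Qed.

Section Fixed.
Variable f : {ffun 'I_n -> 'I_r}.

(** [inside] and [missing] are 0/1 indicators of ordered pairs, so double sums count every unordered
    pair twice. *)
Definition inside (x y : 'I_n) : nat := e x y && (f x == f y).
Definition missing (x y : 'I_n) : nat := (f x != f y) && ~~ e x y.
Definition miss_deg x := (\sum_y missing x y)%N.
Definition class_card (j : 'I_r) := #|[set x | f x == j]|.

Lemma inside_sym x y : inside x y = inside y x.
Proof. by case: ge => se _; rewrite /inside se eq_sym. Qed.

Lemma missing_sym x y : missing x y = missing y x.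
Proof. by case: ge => se _; rewrite /missing se eq_sym. Qed.

Lemma sum_inside : (\sum_x \sum_y inside x y = 2 * mono_edges e f)%N.
Proof.
have -> : mono_edges e f = (\sum_(x : 'I_n) \sum_(y : 'I_n) (x < y) * inside x y)%N.
  rewrite pair_big /= /mono_edges -sum1_card big_mkcond; apply: eq_bigr => -[x y] _.
  by rewrite inE /inside /=; case: (x < y)%N => //=; case: (_ && _).
rewrite mul2n -addnn [X in (_ = X + _)%N]exchange_big -big_split; apply: eq_bigr => x _.
rewrite -big_split; apply: eq_bigr => y _ /=; rewrite (inside_sym y x) -mulnDl.
case: (ltngtP x y) => [||/val_inj->]; rewrite ?mul1n //.
by case: ge => _ ie; rewrite /inside ie.
Qed.

Lemma sum_square_classes : (\sum_x \sum_y (f x == f y) = \sum_j class_card j ^ 2)%N.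
Proof.
rewrite (partition_big f predT) //=; apply: eq_bigr => j _.
rewrite (eq_bigr (fun=> class_card j)).
  by rewrite sum_nat_const -mulnn /class_card; congr (_ * _)%N; apply: eq_card => x; rewrite inE.
move=> x /eqP fx; rewrite /class_card -sum1_card [RHS]big_mkcond.
by apply: eq_bigr => y _; rewrite inE fx eq_sym; case: (_ == _).
Qed.

Lemma sum_classes : (\sum_j class_card j = n)%N.
Proof.
rewrite -[RHS]card_ord -sum1_card (partition_big f predT) //=; apply: eq_bigr => j _.
by rewrite /class_card -sum1_card; apply: eq_bigl => x; rewrite inE.
Qed.

(** Every ordered pair is missing, adjacent or of one colour, and the pairs counted by [inside] are
    exactly those of two of these kinds. *)
Lemma missing_count :
  (\sum_x miss_deg x + \sum_x \sum_y e x y + \sum_j class_card j ^ 2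
   = n ^ 2 + \sum_x \sum_y inside x y)%N.
Proof.
have -> : (n ^ 2 = \sum_(x : 'I_n) \sum_(y : 'I_n) 1)%N.
  by rewrite !sum_nat_const !card_ord muln1.
rewrite -sum_square_classes -!big_split; apply: eq_bigr => x _ /=.
rewrite -!big_split; apply: eq_bigr => y _ /=.
by rewrite /missing /inside; case: (e x y); case: (f x == f y).
Qed.

Lemma class_card_le j : (class_card j <= n)%N.
Proof. by rewrite -[leqRHS]card_ord max_card. Qed.

(** Cauchy-Schwarz over the other [r - 1] classes. With [V] the class size and [Q] the sum of
    squares, this is the division-free form of [r (V - n/r)^2 <= (r - 1) (Q - n^2/r)]. *)
Lemma class_card_variance j :
  ((n - class_card j) ^ 2 + r.-1 * class_card j ^ 2
   <= r.-1 * \sum_k class_card k ^ 2)%N.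
Proof.
have := cauchy_schwarz_nat (predC1 j) class_card.
rewrite cardC1 card_ord => CS.
have -> : (n - class_card j = \sum_(k in predC1 j) class_card k)%N.
  by rewrite -{1}sum_classes (bigD1 j) //= addKn.
by rewrite [X in (_ <= _ * X)%N](bigD1 j) //= mulnDr addnC leq_add2l.
Qed.

(** Across distinct colour classes non-adjacent means missing, and the [N j] are disjoint subsets of
    [S], so the pairs found by [transversal_missing] are distinct missing pairs within [S]. *)
Lemma transversal_missing_avoid (I : finType) (h : I -> 'I_r) (N : I -> {set 'I_n})
    (S : {set 'I_n}) (g : nat) :
  injective h -> (forall j x, x \in N j -> f x = h j) -> (forall j, N j \subset S) ->
  (forall j, (g <= #|N j|)%N) ->
  (forall p : I -> 'I_n, (forall j, p j \in N j) ->
     ~ (forall j k, j != k -> e (p j) (p k))) ->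
  (2 * g ^ 2 <= \sum_(x in S) \sum_(y in S) missing x y)%N.
Proof.
move=> ih fN sN gN bad; case: (ge) => se ie.
have dN j k x : x \in N j -> x \in N k -> j = k.
  by move=> /fN xj /fN xk; apply: ih; rewrite -xj -xk.
apply: leq_trans (transversal_missing se gN _) _.
  move=> p pN; case: (boolP [exists j, exists k, (j != k) && ~~ e (p j) (p k)]).
    by move=> /existsP[j /existsP[k /andP[jk ne]]]; exists j, k.
  move=> H; case: (bad p pN) => j k jk; apply: contraR H => ne.
  by apply/existsP; exists j; apply/existsP; exists k; rewrite jk.
apply: leq_trans (sum_disjoint_le _ dN sN); apply: leq_sum => j _.
rewrite exchange_big; apply: leq_sum => x xj /=.
apply: leq_trans (sum_disjoint_le _ dN sN).
rewrite big_mkcond; apply: leq_sum => k _; case: ifP => // jk.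
apply: leq_sum => y yk; rewrite /missing (fN _ _ xj) (fN _ _ yk).
by rewrite (inj_eq ih) jk.
Qed.

Hypothesis nK : kcount e r.+1 = 0%N.

(** The common neighbours of [v] and [w] in the other [r - 1] classes have no transversal clique,
    since it would complete [v w] to a [K_(r+1)]. The class [j] has the fewest, [g] of them, and
    each of its other vertices forms a missing pair with [v] or [w]. *)
Lemma inside_edge v w : (2 <= r)%N -> e v w -> f v = f w ->
  exists j g, (2 * g ^ 2 <= \sum_x miss_deg x)%N /\
              (class_card j <= g + (miss_deg v + miss_deg w))%N.
Proof.
move=> r2 evw fvw; case: (ge) => se ie.
pose I : finType := {k : 'I_r | k != f v}.
have cI : #|I| = r.-1 by rewrite card_sig cardC1 card_ord.
pose N (k : I) := [set y | (f y == val k) && (e v y && e w y)].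
have [j0 _] : exists j : I, true.
  by have /card_gt0P[j _] : (0 < #|I|)%N; [rewrite cI -ltnS prednK // ltnW|exists j].
have [j _ jmin] := @arg_minnP _ j0 xpredT (fun j => #|N j|) isT.
exists (val j), #|N j|; split.
  rewrite /miss_deg -sum_setT2.
  apply: (@transversal_missing_avoid I val N).
  - exact: val_inj.
  - by move=> k x; rewrite inE => /andP[/eqP].
  - by move=> k; apply: subsetT.
  - by move=> k; apply: jmin.
  move=> p pN cl; have [cA sA] := transversal_clique cl.
  have H x : x \in [set p i | i : I] -> e v x && e w x.
    by case/imsetP=> i _ ->; have := pN i; rewrite inE => /andP[].
  have exw : extends e [set p i | i : I] w.
    by apply/forall_inP => x /H/andP[].
  have exv : extends e (w |: [set p i | i : I]) v.
    by apply/forall_inP => x /setU1P[->//|/H/andP[]].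
  have vN := extends_notin ge exv; have wN := extends_notin ge exw.
  have cQ : is_clique e (v |: (w |: [set p i | i : I])).
    by rewrite clique_setU1 // exv andbT clique_setU1 // cA exw.
  apply: (negP (kcount0_clique nK cQ)).
  by rewrite cardsU1 vN cardsU1 wN sA cI !add1n prednK // ltnW.
rewrite /class_card /miss_deg -big_split -!sum1_card /=.
rewrite [leqLHS]big_mkcond [X in (_ <= X + _)%N]big_mkcond -big_split.
apply: leq_sum => y _ /=; rewrite !inE; case: eqP => //= fy.
by rewrite /missing fy -fvw eq_sym (valP j); case: (e v y); case: (e w y).
Qed.

(** The neighbours of [v] contain no [K_r], and deleting [A] costs each class at most [#|A|] of
    them. The truncated difference is 0 when [A] is large. *)
Lemma neighbourhood_missing (A : {set 'I_n}) v (D : nat) :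
  (forall j, (D <= #|[set y | (f y == j) && e v y]|)%N) ->
  (2 * (D - #|A|) ^ 2 <= \sum_(x in ~: A) \sum_(y in ~: A) missing x y)%N.
Proof.
move=> DN; pose N j := [set y | (f y == j) && e v y] :\: A.
apply: (@transversal_missing_avoid _ id N).
- by [].
- by move=> k x; rewrite !inE => /andP[_ /andP[/eqP]].
- by move=> k; apply/subsetP => x; rewrite !inE => /andP[].
- move=> j; rewrite /N cardsD; apply: leq_sub (DN j) _.
  by apply: subset_leq_card; apply: subsetIr.
move=> p pN cl; have [cA sA] := transversal_clique cl.
have exv : extends e [set p i | i : 'I_r] v.
  by apply/forall_inP => _ /imsetP[i _ ->]; have := pN i; rewrite !inE => /andP[_ /andP[]].
have vN := extends_notin ge exv.
have cQ : is_clique e (v |: [set p i | i : 'I_r]) by rewrite clique_setU1 // cA exv.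
apply: (negP (kcount0_clique nK cQ)).
by rewrite cardsU1 vN sA card_ord.
Qed.

(** Missing degrees summed over [A], in both orientations, cover the missing pairs meeting [A]; only
    pairs inside [A] are covered twice, an excess of at most [#|A| ^ 2]. *)
Lemma missing_split (A : {set 'I_n}) :
  (\sum_(x in ~: A) \sum_(y in ~: A) missing x y + 2 * \sum_(x in A) miss_deg x
   <= \sum_x miss_deg x + #|A| ^ 2)%N.
Proof.
have -> : (#|A| ^ 2 = \sum_x \sum_y (x \in A) * (y \in A))%N.
  rewrite -mulnn -!sum1_card big_distrl /= sum_mem_indicator; apply: eq_bigr => x _.
  rewrite mul1n sum_mem_indicator -big_distrr /=; congr (_ * _)%N.
  by apply: eq_bigr => y _; rewrite muln1.
have SA : (\sum_(x in A) miss_deg x = \sum_x \sum_y (x \in A) * missing x y)%N.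
  by rewrite sum_mem_indicator; apply: eq_bigr => x _; rewrite big_distrr.
have SA' : (\sum_(x in A) miss_deg x = \sum_x \sum_y (y \in A) * missing x y)%N.
  rewrite SA exchange_big; apply: eq_bigr => x _; apply: eq_bigr => y _.
  by rewrite missing_sym.
rewrite mul2n -addnn [X in (_ + (X + _) <= _)%N]SA SA'.
rewrite sum_mem_indicator -!big_split; apply: leq_sum => x _.
rewrite sum_mem_indicator big_distrr /= -!big_split; apply: leq_sum => y _ /=.
rewrite !inE /missing.
by case: (x \in A); case: (y \in A); case: (_ && _).
Qed.

End Fixed.

End Colouring.

(** * Colourings with the fewest monochromatic edges *)

Section Minimal.
Variables (n r : nat) (e : rel 'I_n).
Hypothesis ge : is_graph e.

Lemma Dr_le (f : {ffun 'I_n -> 'I_r}) : (Dr r e <= mono_edges e f)%N.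
Proof.
rewrite /Dr; elim: (index_enum _) (mem_index_enum f) => // g s IH.
by rewrite big_cons inE geq_min => /orP[/eqP<-|/IH->]; rewrite ?leqnn ?orbT.
Qed.

(** Otherwise moving [v] to class [j] would lower the number of monochromatic edges. *)
Lemma minimal_inside (f : {ffun 'I_n -> 'I_r}) v j :
  (forall g : {ffun 'I_n -> 'I_r}, (mono_edges e f <= mono_edges e g)%N) ->
  (\sum_y inside e f v y <= #|[set y | (f y == j) && e v y]|)%N.
Proof.
case: (ge) => se ie fmin.
pose g : {ffun 'I_n -> 'I_r} := [ffun y => if y == v then j else f y].
(* Only the second term depends on the colour of [v]. *)
have split (h : {ffun 'I_n -> 'I_r}) : (2 * mono_edges e h =
    \sum_(x in [set~ v]) \sum_(y in [set~ v]) inside e h x y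
    + 2 * \sum_y inside e h v y)%N.
  rewrite -sum_inside //.
  rewrite -sum_setT2.
  rewrite (sum_sym_split (inside_sym ge h) (subsetT [set~ v])); congr (_ + _)%N.
  rewrite (big_pred1 v) => [|x]; last by rewrite !inE negbK andbT.
  have E : (\sum_(y in [set~ v]) inside e h v y = \sum_y inside e h v y)%N.
    rewrite [RHS](bigD1 v) //= {2}/inside ie add0n.
    by apply: eq_bigl => y; rewrite !inE.
  rewrite E mul2n -addnn; congr (_ + _)%N; by apply: eq_bigl => y; rewrite inE.
have : (2 * mono_edges e f <= 2 * mono_edges e g)%N by rewrite leq_mul2l fmin.
rewrite !split.
have -> : (\sum_(x in [set~ v]) \sum_(y in [set~ v]) inside e g x y
           = \sum_(x in [set~ v]) \sum_(y in [set~ v]) inside e f x y)%N.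
  apply: eq_bigr => x; rewrite !inE => /negPf xv.
  by apply: eq_bigr => y; rewrite !inE /inside !ffunE xv => /negPf->.
rewrite leq_add2l leq_mul2l /= => /leq_trans; apply.
rewrite -sum1_card [leqRHS]big_mkcond; apply: leq_sum => y _.
rewrite inE /inside !ffunE eqxx; case: (eqVneq y v) => [->|_]; first by rewrite ie.
by rewrite eq_sym; case: (e v y); case: (_ == _).
Qed.

Hypothesis nK : kcount e r.+1 = 0%N.

(** [furedi_on] for the whole vertex set; Cauchy-Schwarz over the classes bounds the ordered
    bichromatic pairs by [(1 - 1/r) n^2]. *)
Lemma furedi : exists f : {ffun 'I_n -> 'I_r},
  (r * (\sum_x \sum_y e x y + 2 * mono_edges e f) <= r.-1 * n ^ 2)%N.
Proof.
have [|f [fr fF]] := @furedi_on n e ge r setT.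
  by move=> B _; apply: kcount0_clique.
exists [ffun x => Ordinal (fr x (in_setT x))]; set h : {ffun 'I_n -> 'I_r} := [ffun _ => _].
have hE x y : (h x == h y) = (f x == f y) by rewrite !ffunE -val_eqE.
have {}fF : (\sum_x \sum_y e x y + 2 * mono_edges e h
             <= \sum_x \sum_y (h x != h y))%N.
  rewrite -sum_inside //; move: fF.
  rewrite !sum_setT2 /inside => H.
  apply: leq_trans (leq_trans _ H) _.
    rewrite leq_add2l; apply: leq_sum => x _; apply: leq_sum => y _; by rewrite hE.
  by apply: leq_sum => x _; apply: leq_sum => y _; rewrite hE.
apply: leq_trans (leq_mul (leqnn r) fF) _.
have P : (\sum_x \sum_y (h x != h y) + \sum_j class_card h j ^ 2 = n ^ 2)%N.
  have -> : (n ^ 2 = \sum_(x : 'I_n) \sum_(y : 'I_n) 1)%N.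
    by rewrite !sum_nat_const !card_ord muln1.
  rewrite -sum_square_classes -!big_split; apply: eq_bigr => x _ /=.
  by rewrite -!big_split; apply: eq_bigr => y _ /=; case: (h x == h y).
have := cauchy_schwarz_nat predT (class_card h).
rewrite sum_classes card_ord -P.
move: (\sum_x _)%N (\sum_j _)%N => S Q.
case: (r) => [//|m] /= H; nia.
Qed.

(** Condenses the combinatorics into numerical inequalities. [W] counts ordered missing pairs and
    [Q] is the sum of squared class sizes; [a] and [b] count the vertices of missing degree at least
    [ta] and [tb], and [D] is the largest monochromatic degree. *)
Lemma extremal_colouring : (2 <= r)%N ->
  exists f : {ffun 'I_n -> 'I_r}, let U := (2 * mono_edges e f)%N in
  exists W Q : nat,
  [/\ (r * (2 * kcount e 2 + U) <= r.-1 * n ^ 2)%N,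
      (W + 2 * kcount e 2 + Q = n ^ 2 + U)%N,
      forall j, (class_card f j <= n)%N /\
        ((n - class_card f j) ^ 2 + r.-1 * class_card f j ^ 2 <= r.-1 * Q)%N &
      forall ta tb : nat,
        (forall j g, (2 * g ^ 2 <= W)%N -> (g + ta + tb <= class_card f j)%N) ->
        exists a b D : nat,
        [/\ (a * ta <= W)%N, (b * tb <= W)%N, (2 * D ^ 2 <= W)%N,
            (U <= b ^ 2 + 2 * (a * D))%N &
            (2 * (D - a) ^ 2 + 2 * (a * ta) <= W + a ^ 2)%N]].
Proof.
move=> r2; have [f0 Hf0] := furedi.
have [f _ fmin] := @arg_minnP _ f0 xpredT (fun g : {ffun 'I_n -> 'I_r} => mono_edges e g) isT.
have {}fmin (g : {ffun 'I_n -> 'I_r}) : (mono_edges e f <= mono_edges e g)%N.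
  exact: fmin.
exists f => U; set W := (\sum_x miss_deg e f x)%N.
exists W, (\sum_j class_card f j ^ 2)%N; split.
- rewrite -kcount2_double //; apply: leq_trans Hf0.
  by rewrite leq_mul2l leq_add2l leq_mul2l fmin !orbT.
- by rewrite -kcount2_double // missing_count sum_inside.
- by move=> j; split; [apply: class_card_le|apply: class_card_variance].
move=> ta tb Hg.
pose A := [set x | (ta <= miss_deg e f x)%N].
pose B := [set x | (tb <= miss_deg e f x)%N].
pose D := (\max_v \sum_y inside e f v y)%N.
have degD v : (\sum_y inside e f v y <= D)%N by apply: leq_bigmax.
have DA S : (2 * (D - #|S : {set 'I_n}|) ^ 2
             <= \sum_(x in ~: S) \sum_(y in ~: S) missing e f x y)%N.
  case: (posnP D) => [->//|Dp].
  have [v Dv] : exists v, D = (\sum_y inside e f v y)%N.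
    case: (pickP (fun _ : 'I_n => true)) => [x0 _|no].
      have [|v Dv] := eq_bigmax (fun v => \sum_y inside e f v y)%N; last by exists v.
      by apply/card_gt0P; exists x0.
    by move: Dp; rewrite /D big_pred0.
  apply: (@neighbourhood_missing _ _ _ ge f nK S v) => j; rewrite Dv.
  exact: minimal_inside.
have thr S t : S = [set x | (t <= miss_deg e f x)%N] ->
    (#|S| * t <= \sum_(x in S) miss_deg e f x)%N.
  by move=> ->; rewrite -sum_nat_const; apply: leq_sum => x; rewrite inE.
have leW (S : {set 'I_n}) : (\sum_(x in S) miss_deg e f x <= W)%N.
  by rewrite /W [leqRHS](bigID (mem S)) /= leq_addr.
exists #|A|, #|B|, D; split.
- exact: leq_trans (thr A ta _) (leW A).
- exact: leq_trans (thr B tb _) (leW B).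
- have := DA set0; rewrite cards0 subn0 => /leq_trans; apply.
  by rewrite setC0 sum_setT2.
(* If a monochromatic edge has an endpoint outside [B], the other endpoint is in [A]: by
   [inside_edge] and [Hg] the two missing degrees sum to at least [ta + tb]. *)
- have pw x y : (inside e f x y <= (x \in B) * (y \in B)
      + ((x \in A) * inside e f x y + (y \in A) * inside e f x y))%N.
    rewrite {1}/inside; case: (boolP (e x y && _)) => // /[dup] xy /andP[exy /eqP fxy].
    have [j [g [gW jg]]] := inside_edge ge nK r2 exy fxy.
    have := Hg j g gW; rewrite /inside xy !inE; move: jg.
    case: (leqP tb (miss_deg e f x)); case: (leqP tb (miss_deg e f y)) => //=;
    case: (leqP ta (miss_deg e f x)); case: (leqP ta (miss_deg e f y)) => //=; lia.
  rewrite /U -sum_inside //.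
  apply: leq_trans (leq_sum _ (fun x _ => leq_sum _ (fun y _ => pw x y))) _.
  under eq_bigr => x _ do rewrite big_split /=.
  rewrite big_split /=; apply: leq_add.
    rewrite -mulnn -!sum1_card big_distrl /= [leqRHS]sum_mem_indicator.
    apply: leq_sum => x _; rewrite -big_distrr /= mul1n leq_mul2l.
    by rewrite [leqRHS]sum_mem_indicator; apply/orP; right; apply: leq_sum => y _; rewrite muln1.
  under eq_bigr => x _ do rewrite big_split /=.
  have aD : (\sum_x \sum_y (x \in A) * inside e f x y <= #|A| * D)%N.
    rewrite -sum_nat_const sum_mem_indicator; apply: leq_sum => x _.
    by rewrite -big_distrr leq_mul2l degD orbT.
  rewrite big_split /= mul2n -addnn leq_add // exchange_big.
  apply: leq_trans aD; apply: leq_sum => x _; apply: leq_sum => y _.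
  by rewrite inside_sym.
- apply: leq_trans (missing_split ge f A).
  by rewrite leq_add ?DA // leq_mul2l /= thr.
Qed.

End Minimal.

Open Scope R_scope.

(** * Real estimates *)

Lemma INR_addn (m k : nat) : INR (m + k)%N = INR m + INR k.
Proof. exact: plus_INR. Qed.

Lemma INR_muln (m k : nat) : INR (m * k)%N = INR m * INR k.
Proof. exact: mult_INR. Qed.

Lemma INR_expn (m k : nat) : INR (m ^ k)%N = INR m ^ k.
Proof. by elim: k => [//|k IH]; rewrite expnS INR_muln IH. Qed.

Lemma INR_subn (m k : nat) : (k <= m)%N -> INR (m - k)%N = INR m - INR k.
Proof. by move=> /leP km; exact: minus_INR. Qed.

Lemma INR_leq (m k : nat) : (m <= k)%N -> INR m <= INR k.
Proof. by move/leP/le_INR. Qed.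

Lemma leq_INR (m k : nat) : INR m <= INR k -> (m <= k)%N.
Proof. by move=> H; apply/leP; apply: INR_le. Qed.

Lemma INR_2 : INR 2 = 2.
Proof. by rewrite INR_IZR_INZ. Qed.

Definition INR_nat := (INR_addn, INR_muln, INR_expn).

Lemma nat_floor (x : R) : 0 <= x -> exists k : nat, INR k <= x < INR k + 1.
Proof.
move=> x0; have [H1 H2] := base_Int_part x.
have z0 : (0 <= Int_part x)%Z by apply Z.lt_succ_r; apply: lt_IZR; rewrite succ_IZR; lra.
exists (Z.to_nat (Int_part x)); rewrite INR_IZR_INZ Z2Nat.id //; lra.
Qed.

Lemma le_of_sqr_le (x y : R) : 0 <= y -> x * x <= y * y -> x <= y.
Proof. by move=> y0 xy; nra. Qed.

(* The cubic [x * (p ^ 2 - x ^ 2)] is maximal at [x = p / sqrt 3]. *)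
Lemma cubic_bound (x p : R) : 0 <= x -> 0 <= p ->
  x * (p ^ 2 - x ^ 2) <= 2 / (3 * sqrt 3) * p ^ 3.
Proof.
move=> x0 p0; have q0 : 0 < sqrt 3 by apply: sqrt_lt_R0; lra.
have q2 : sqrt 3 * sqrt 3 = 3 by apply: sqrt_sqrt; lra.
set q := p / sqrt 3.
have pq : p = q * sqrt 3 by rewrite /q; field; lra.
have q0' : 0 <= q by apply: Rmult_le_pos => //; apply: Rlt_le; apply: Rinv_0_lt_compat.
have -> : 2 / (3 * sqrt 3) * p ^ 3 = 2 * q ^ 3.
  transitivity (2 / 3 * (q ^ 3) * (sqrt 3 * sqrt 3)); first by rewrite pq; field; lra.
  by rewrite q2; field.
have -> : p ^ 2 = 3 * q ^ 2.
  by transitivity (sqrt 3 * sqrt 3 * q ^ 2); [rewrite pq; ring|rewrite q2].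
(* This product is [2 q^3 - x (3 q^2 - x^2)]. *)
have : 0 <= (x - q) ^ 2 * (x + 2 * q) by apply: Rmult_le_pos; [exact: pow2_ge_0|lra].
by move=> H; nra.
Qed.

(** The quantities of [extremal_colouring] divided by [n] or [n^2], with [x] for [D] and [bt ^ 8]
    for [alpha]. Since [a], [b], [x] are of order at most [bt^8], [bt^7], [bt^4], the product
    [a * x] has order at most [bt^12] and [b ^ 2] is negligible. *)
Lemma normalized_bound (r bt u w a b x t tb : R) :
  2 <= r -> 0 < bt -> bt * (10 * r) <= 1 ->
  w <= 2 * bt ^ 8 + u -> u <= 2 * bt ^ 8 ->
  0 <= a -> 0 <= b -> 0 <= x ->
  1 / r - 5 * bt <= t -> bt <= tb ->
  a * t <= w -> b * tb <= w -> 2 * x ^ 2 <= w ->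
  u <= b ^ 2 + 2 * (a * x) ->
  2 * (x ^ 2 - 2 * x * a) + 2 * (a * t) <= w + a ^ 2 ->
  u / 2 <= (2 * r / (3 * sqrt 3) + 264 * r ^ 3 * bt) * bt ^ 12.
Proof.
move=> r2 b0 br Hw Hu a0 bb0 x0 Ht Htb Ha Hb Hx HU HA.
have bt1 : bt <= 1 by nra.
have pw k : 0 < bt ^ k by apply: pow_lt.
have w4 : w <= 4 * bt ^ 8 by lra.
have i0 : 0 < / r by apply: Rinv_0_lt_compat; lra.
have ir : r * / r = 1 by field; lra.
have ht : / r / 2 <= t by nra.
have a8 : a <= 8 * r * bt ^ 8.
  have H : a * (/ r / 2) <= 4 * bt ^ 8 by nra.
  have -> : a = a * (/ r / 2) * (2 * r) by field; lra.
  have : 0 <= (4 * bt ^ 8 - a * (/ r / 2)) * (2 * r) by apply: Rmult_le_pos; lra.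
  by lra.
have b4 : b <= 4 * bt ^ 7.
  have H : b * bt <= 4 * bt ^ 7 * bt.
    have -> : 4 * bt ^ 7 * bt = 4 * bt ^ 8 by ring.
    by nra.
  exact: Rmult_le_reg_r H.
have x2 : x <= 2 * bt ^ 4.
  apply: le_of_sqr_le; first by have := pw 4%N; lra.
  have -> : 2 * bt ^ 4 * (2 * bt ^ 4) = 4 * bt ^ 8 by ring.
  by have := pw 8%N; nra.
have mono k m : (k <= m)%N -> bt ^ m <= bt ^ k.
  move=> km; rewrite -(subnK km) pow_add.
  have H : bt ^ (m - k) <= 1 by rewrite -(pow1 (m - k)); apply: pow_incr; lra.
  by have := pw k; nra.
have ax : a * x <= 16 * r * bt ^ 12.
  have -> : 16 * r * bt ^ 12 = (8 * r * bt ^ 8) * (2 * bt ^ 4) by ring.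
  exact: Rmult_le_compat.
have bsq : b ^ 2 <= 16 * bt ^ 14.
  have -> : 16 * bt ^ 14 = (4 * bt ^ 7) ^ 2 by ring.
  by apply: pow_incr.
have asq : a ^ 2 <= 64 * r ^ 2 * bt ^ 16.
  have -> : 64 * r ^ 2 * bt ^ 16 = (8 * r * bt ^ 8) ^ 2 by ring.
  by apply: pow_incr.
have m12 := mono 12%N 14%N isT.
have m9 := mono 9%N 12%N isT.
have m16 := mono 9%N 16%N isT.
have p9 := pw 9%N.
(* Bootstrapping: this sharpens [w <= 4 bt^8] to [w <= 2 bt^8 + 48 r bt^12], which gives [A1] the
   right leading term [bt^8 - x^2]. *)
have u48 : u <= 48 * r * bt ^ 12 by have := pw 12%N; nra.
have rr : r <= r ^ 2 / 2 by nra.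
have ab : a * bt <= 8 * r * bt ^ 9.
  have -> : 8 * r * bt ^ 9 = 8 * r * bt ^ 8 * bt by ring.
  by apply: Rmult_le_compat_r; lra.
have A1 : a / r <= bt ^ 8 - x ^ 2 + 128 * r ^ 2 * bt ^ 9.
  have E1 : a / r <= a * t + 5 * (a * bt).
    have : 0 <= a * (t - (1 / r - 5 * bt)) by apply: Rmult_le_pos; lra.
    by rewrite /Rdiv; lra.
  have E2 : 40 * r * bt ^ 9 <= 20 * r ^ 2 * bt ^ 9 by nra.
  have E3 : 56 * r * bt ^ 12 <= 28 * r ^ 2 * bt ^ 9.
    apply: Rle_trans (_ : 56 * r * bt ^ 9 <= _); last by nra.
    by apply: Rmult_le_compat_l; lra.
  have E4 : 32 * r ^ 2 * bt ^ 16 <= 32 * r ^ 2 * bt ^ 9 by apply: Rmult_le_compat_l; nra.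
  have E5 : 0 <= r ^ 2 * bt ^ 9 by apply: Rmult_le_pos; nra.
  by lra.
have A2 : a * x <= r * (x * (bt ^ 8 - x ^ 2)) + 256 * r ^ 3 * bt ^ 13.
  have -> : a * x = a / r * (r * x) by field; lra.
  apply: Rle_trans (_ : (bt ^ 8 - x ^ 2 + 128 * r ^ 2 * bt ^ 9) * (r * x) <= _).
    by apply: Rmult_le_compat_r => //; nra.
  have : 128 * r ^ 3 * bt ^ 9 * x <= 128 * r ^ 3 * bt ^ 9 * (2 * bt ^ 4).
    apply: Rmult_le_compat_l => //; apply: Rmult_le_pos; last lra.
    by have := pow_lt r 3; lra.
  have -> : 128 * r ^ 3 * bt ^ 9 * (2 * bt ^ 4) = 256 * r ^ 3 * bt ^ 13 by ring.
  by lra.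
have C : r * (x * (bt ^ 8 - x ^ 2)) <= r * (2 / (3 * sqrt 3) * bt ^ 12).
  apply: Rmult_le_compat_l; first lra.
  have := @cubic_bound x (bt ^ 4) x0 (Rlt_le _ _ (pw 4%N)).
  by rewrite -!pow_mult.
have m13 := mono 13%N 14%N isT; have p13 := pw 13%N.
have r3 : 1 <= r ^ 3 by rewrite -(pow1 3); apply: pow_incr; lra.
have F : 8 * bt ^ 14 <= 8 * r ^ 3 * bt ^ 13 by nra.
(* The constant 264 is 256 from [a * x] plus 8 from [b ^ 2 / 2]. *)
have -> : (2 * r / (3 * sqrt 3) + 264 * r ^ 3 * bt) * bt ^ 12
   = r * (2 / (3 * sqrt 3) * bt ^ 12) + 264 * r ^ 3 * bt ^ 13 by rewrite /Rdiv; ring.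
lra.
Qed.

(** * Stability in terms of the number of edges *)

Lemma edge_stability (n r : nat) (e : rel 'I_n) (bt : R) :
  is_graph e -> (2 <= r)%N -> kcount e r.+1 = 0%N ->
  0 < bt -> bt * (10 * INR r) <= 1 ->
  (1 - / INR r) * INR n ^ 2 - 2 * bt ^ 8 * INR n ^ 2 <= 2 * INR (kcount e 2) ->
  INR (Dr r e) <=
    (2 * INR r / (3 * sqrt 3) + 264 * INR r ^ 3 * bt) * bt ^ 12 * INR n ^ 2.
Proof.
move=> ge r2 nK b0 br HE.
have [f] := extremal_colouring ge nK r2.
set m := mono_edges e f => -[W [Q [HU HW HV core]]].
apply: Rle_trans (INR_leq (Dr_le e f)) _; rewrite -/m.
have R2 : 2 <= INR r by have := INR_leq r2.
have i0 : 0 < / INR r by apply: Rinv_0_lt_compat; lra.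
have ir : INR r * / INR r = 1 by field; lra.
have ir2 : / INR r <= / 2 by apply: Rinv_le_contravar; lra.
have q0 : 0 < sqrt 3 by apply: sqrt_lt_R0; lra.
have bt20 : bt <= / 20 by nra.
have pw k : 0 < bt ^ k by apply: pow_lt.
have [m0|mp] := posnP m.
  rewrite m0 /=; apply: Rmult_le_pos; last by have := pow2_ge_0 (INR n).
  apply: Rmult_le_pos; last exact: Rlt_le (pw 12%N).
  apply: Rplus_le_le_0_compat.
    by apply: Rmult_le_pos; [lra|apply: Rlt_le; apply: Rinv_0_lt_compat; lra].
  by apply: Rmult_le_pos; [have := pow_le (INR r) 3; lra|lra].
have {}mp : 1 <= INR m by exact: (INR_leq mp).
have rp : INR r.-1 = INR r - 1 by rewrite -subn1 INR_subn // ltnW.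
set N := INR n in HE *.
have N0 : 0 <= N by apply: pos_INR.
have {}HU : INR m <= bt ^ 8 * N ^ 2.
  have := INR_leq HU; rewrite !INR_nat rp -/N INR_2 => H.
  apply: (Rmult_le_reg_l (INR r)); first lra.
  have : INR r * ((1 - / INR r) * N ^ 2 - 2 * bt ^ 8 * N ^ 2)
         <= INR r * (2 * INR (kcount e 2)) by apply: Rmult_le_compat_l; lra.
  have -> : INR r * ((1 - / INR r) * N ^ 2 - 2 * bt ^ 8 * N ^ 2)
    = (INR r - INR r * / INR r) * N ^ 2 - 2 * INR r * bt ^ 8 * N ^ 2 by ring.
  rewrite ir; lra.
(* A single monochromatic edge forces [bt * n >= 1], which absorbs the rounding of the thresholds;
   this is why [m = 0] was treated apart. *)
have bN : 1 <= bt * N.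
  case: (Rle_lt_dec 1 (bt * N)) => // H.
  have : bt ^ 8 * N ^ 2 <= (bt * N) ^ 2.
    have -> : bt ^ 8 * N ^ 2 = bt ^ 6 * (bt * N) ^ 2 by ring.
    have : bt ^ 6 <= 1 by rewrite -(pow1 6); apply: pow_incr; lra.
    by have := pow2_ge_0 (bt * N); nra.
  have : 0 <= bt * N by apply: Rmult_le_pos; lra.
  by nra.
have Np : 0 < N by nra.
have {}HW : INR W + 2 * INR (kcount e 2) + INR Q = N ^ 2 + 2 * INR m.
  by have := congr1 INR HW; rewrite !INR_nat.
have {}HV (j : 'I_r) :
    INR r * (INR (class_card f j) - N * / INR r) ^ 2
    <= (INR r - 1) * (INR Q - N ^ 2 * / INR r).
  have [Vn] := HV j; move=> /INR_leq; rewrite !INR_nat INR_subn // rp -/N.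
  set V := INR (class_card f j) => H.
  have -> : INR r * (V - N * / INR r) ^ 2
    = INR r * V ^ 2 - 2 * V * N * (INR r * / INR r)
      + N ^ 2 * (INR r * / INR r) * / INR r by ring.
  have -> : (INR r - 1) * (INR Q - N ^ 2 * / INR r)
    = (INR r - 1) * INR Q - N ^ 2 * (INR r * / INR r) + N ^ 2 * / INR r by ring.
  by rewrite ir; lra.
have Qlow : N ^ 2 * / INR r <= INR Q.
  have r0 : (0 < r)%N by apply: ltnW.
  have := HV (Ordinal r0); have := pow2_ge_0 (INR (class_card f (Ordinal r0)) - N * / INR r).
  by nra.
have W2 : INR W <= 2 * bt ^ 8 * N ^ 2 + 2 * INR m by lra.
have W4 : INR W <= 4 * bt ^ 8 * N ^ 2 by lra.
have b4 : bt ^ 4 <= bt / 8000.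
  have -> : bt ^ 4 = bt * bt ^ 3 by ring.
  have : bt ^ 3 <= (/ 20) ^ 3 by apply: pow_incr; lra.
  by nra.
(* [Q] exceeds [n^2/r] by at most [4 bt^8 n^2], so [HV] keeps every class size within [2 bt^4 n] of
   [n/r]. *)
have Vlow (j : 'I_r) : N * / INR r - 2 * bt ^ 4 * N <= INR (class_card f j).
  have Qup : INR Q - N ^ 2 * / INR r <= 4 * bt ^ 8 * N ^ 2.
    by have := pos_INR W; lra.
  have {}HV := HV j; set V := INR (class_card f j) in HV *.
  have H : (N * / INR r - V) * (N * / INR r - V) <= (2 * bt ^ 4 * N) * (2 * bt ^ 4 * N).
    apply: (Rmult_le_reg_l (INR r)); first lra.
    have -> : INR r * ((N * / INR r - V) * (N * / INR r - V))
      = INR r * (V - N * / INR r) ^ 2 by ring.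
    apply: Rle_trans HV _.
    apply: Rle_trans (_ : (INR r - 1) * (4 * bt ^ 8 * N ^ 2) <= _).
      by apply: Rmult_le_compat_l; lra.
    have -> : 2 * bt ^ 4 * N * (2 * bt ^ 4 * N) = 4 * bt ^ 8 * N ^ 2 by ring.
    apply: Rmult_le_compat_r; last lra.
    by have := pw 8%N; have := pow2_ge_0 N; nra.
  suff : N * / INR r - V <= 2 * bt ^ 4 * N by lra.
  apply: le_of_sqr_le H; apply: Rmult_le_pos => //; have := pw 4%N; lra.
have bi : 10 * bt <= / INR r.
  have -> : 10 * bt = bt * (10 * INR r) * / INR r by field; lra.
  by nra.
(* The [4 bt N] given up here pay for [tb + 1 <= 2 bt N], for [g <= 2 bt^4 N] and for the error in
   [Vlow]. Rounding down costs at most one more [bt N]. *)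
have [ta [ta1 ta2]] : exists k : nat, INR k <= (/ INR r - 4 * bt) * N < INR k + 1.
  by apply: nat_floor; apply: Rmult_le_pos; lra.
have [tb [tb1 tb2]] : exists k : nat, INR k <= bt * N < INR k + 1.
  by apply: nat_floor; lra.
have [a [b [D [Ha Hb HD HUab HDa]]]] : exists a b D : nat,
    [/\ (a * ta <= W)%N, (b * tb.+1 <= W)%N, (2 * D ^ 2 <= W)%N,
        (2 * m <= b ^ 2 + 2 * (a * D))%N &
        (2 * (D - a) ^ 2 + 2 * (a * ta) <= W + a ^ 2)%N].
  apply: core => j g /INR_leq; rewrite !INR_nat INR_2 => gW.
  apply: leq_INR; rewrite !INR_nat S_INR.
  apply: Rle_trans (Vlow j).
  have : INR g <= 2 * bt ^ 4 * N.
    apply: le_of_sqr_le; first by apply: Rmult_le_pos => //; have := pw 4%N; lra.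
    have -> : 2 * bt ^ 4 * N * (2 * bt ^ 4 * N) = 4 * bt ^ 8 * N ^ 2 by ring.
    by have := pos_INR W; nra.
  have : bt ^ 4 * N <= bt / 8000 * N by apply: Rmult_le_compat_r.
  by lra.
move: Ha Hb HD HUab => /INR_leq Ha /INR_leq Hb /INR_leq HD /INR_leq HUab.
rewrite !INR_nat ?INR_2 ?S_INR in Ha Hb HD HUab.
(* If [D < a] the truncated square is 0 while [D^2 - 2 D a] is at most 0, so this form holds in both
   cases. *)
have {}HDa : 2 * (INR D ^ 2 - 2 * INR D * INR a) + 2 * (INR a * INR ta) <= INR W + INR a ^ 2.
  have := INR_leq HDa; rewrite !INR_nat INR_2.
  case: (leqP a D) => [aD|/ltnW aD].
    by rewrite INR_subn //; have := pow2_ge_0 (INR a); nra.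
  have := INR_leq aD; have := pos_INR D; have := pos_INR a; have := pow2_ge_0 (INR (D - a)).
  by nra.
have scale (k : nat) : exists2 x, 0 <= x & INR k = x * N.
  exists (INR k / N); last by field; lra.
  by apply: Rmult_le_pos; [exact: pos_INR|apply: Rlt_le; exact: Rinv_0_lt_compat].
have [a' a0 Ea] := scale a; have [b' bb0 Eb] := scale b; have [x x0 Ex] := scale D.
have N2 : 0 < N ^ 2 by apply: pow_lt.
have [u Eu] : exists u, 2 * INR m = u * N ^ 2.
  by exists (2 * INR m / N ^ 2); field; lra.
have [w Ew] : exists w, INR W = w * N ^ 2 by exists (INR W / N ^ 2); field; lra.
have [t Et] : exists t, INR ta = t * N by exists (INR ta / N); field; lra.
have [tb' Etb] : exists t, INR tb + 1 = t * N by exists ((INR tb + 1) / N); field; lra.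
rewrite Ea Eb Ex Et Etb Ew Eu in Ha Hb HD HUab HDa.
suff : u / 2 <= (2 * INR r / (3 * sqrt 3) + 264 * INR r ^ 3 * bt) * bt ^ 12.
  move=> H; have -> : INR m = u / 2 * N ^ 2 by lra.
  by apply: Rmult_le_compat_r; lra.
apply: (@normalized_bound (INR r) bt u w a' b' x t tb') => //;
  first [apply: (Rmult_le_reg_r (N ^ 2)) => //; rewrite -?Eu -?Ew; lra
        |apply: (Rmult_le_reg_r N) => //; rewrite -?Et -?Etb; lra].
Qed.

(** * From clique counts to edge counts *)

Lemma Rpower_small (c p eta : R) : 0 < c -> 0 < p -> 0 < eta ->
  exists th, 0 < th /\ forall d, 0 < d < th -> c * Rpower d p < eta.
Proof.
move=> c0 p0 eta0; exists (Rpower (eta / c) (/ p)); split; first exact: exp_pos.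
move=> d dth; have H := Rlt_Rpower_l _ _ _ p0 dth.
rewrite Rpower_mult Rinv_l ?Rpower_1 in H; [|exact: Rdiv_lt_0_compat|lra].
apply: Rlt_le_trans (Rmult_lt_compat_l c _ _ c0 H) _.
by apply: Req_le; field; lra.
Qed.

Lemma Rpower_exp_pow (x q : R) (k : nat) : Rpower x q ^ k = Rpower x (q * INR k).
Proof. by rewrite -Rpower_pow ?Rpower_mult //; exact: exp_pos. Qed.

Lemma le_Rpower (y q : R) : 0 < y <= 1 -> q <= 1 -> y <= Rpower y q.
Proof.
move=> [y0 y1] q1; rewrite -{1}(exp_ln y) // /Rpower.
have ly : ln y <= 0.
  rewrite -ln_1; case: y1 => [y1|->]; last exact: Rle_refl.
  by apply: Rlt_le; exact: ln_increasing.
have [H|H] : ln y < q * ln y \/ ln y = q * ln y by nra.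
  by apply: Rlt_le; exact: exp_increasing.
by rewrite -H; exact: Rle_refl.
Qed.

Lemma INR_bin2 (r : nat) : (2 <= r)%N -> 2 * INR 'C(r, 2) = INR r * (INR r - 1).
Proof.
move=> r2; have := congr1 INR (mul_bin_diag r 1).
rewrite bin1 !INR_nat INR_2 -subn1 INR_subn; last exact: ltnW.
by rewrite [INR 1]/1 => ->.
Qed.

(** [kcount_le_kcount2] gives [k_2 >= C(r,2) (n/r)^2 (1 - y)] with [y = z r^s]. As [y <= 1] and
    [s >= 2], [y <= y^(2/s) = z^(2/s) r^2]; for [z = d / C(r,s)] the loss is then [alpha n^2]. *)
Lemma edges_of_cliques (n r s : nat) (e : rel 'I_n) (z : R) :
  is_graph e -> (2 <= s)%N -> (s <= r)%N -> (0 < n)%N -> kcount e r.+1 = 0%N ->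
  0 < z -> z * INR r ^ s <= 1 ->
  INR 'C(r, s) * (INR n / INR r) ^ s - z * INR 'C(r, s) * INR n ^ s <= INR (kcount e s) ->
  (1 - / INR r) * INR n ^ 2
    - 2 * (INR 'C(r, 2) * Rpower z (2 / INR s)) * INR n ^ 2 <= 2 * INR (kcount e 2).
Proof.
case: s => [|[|s]] // ge _ sr n0 nK z0 z1 Hs.
have r2 : (2 <= r)%N by apply: leq_trans sr.
have R2 : 2 <= INR r by have := INR_leq r2; rewrite INR_2.
have N0 : 0 < INR n by apply: lt_0_INR; apply/ltP.
have C0 : 0 < INR 'C(r, s.+2) by apply: lt_0_INR; apply/ltP; rewrite bin_gt0.
have D2 := INR_bin2 r2.
have r0 k : 0 < INR r ^ k by apply: pow_lt; lra.
have n0' k : 0 < INR n ^ k by exact: pow_lt.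
have S2 : 2 <= INR s.+2 by have := @INR_leq 2 s.+2 isT; rewrite INR_2.
set y := z * INR r ^ s.+2 in z1.
have y0 : 0 < y by apply: Rmult_lt_0_compat.
have Ey : Rpower y (2 / INR s.+2) = Rpower z (2 / INR s.+2) * INR r ^ 2.
  rewrite /y -Rpower_mult_distr //; congr (_ * _).
  rewrite -(Rpower_pow s.+2) ?Rpower_mult; last lra.
  have -> : INR s.+2 * (2 / INR s.+2) = INR 2 by rewrite INR_2; field; lra.
  by rewrite Rpower_pow //; lra.
have yle : y <= Rpower z (2 / INR s.+2) * INR r ^ 2.
  rewrite -Ey; apply: le_Rpower; first by lra.
  apply: (Rmult_le_reg_r (INR s.+2)); first lra.
  have -> : 2 / INR s.+2 * INR s.+2 = 2 by field; lra.
  by lra.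
have K := INR_leq (kcount_le_kcount2 ge nK sr).
rewrite !INR_nat in K.
have {}K : (1 - y) * (INR 'C(r, 2) * INR n ^ 2) <= INR (kcount e 2) * INR r ^ 2.
  apply: (Rmult_le_reg_r (INR n ^ s * INR 'C(r, s.+2))); first exact: Rmult_lt_0_compat.
  have -> : INR (kcount e 2) * INR r ^ 2 * (INR n ^ s * INR 'C(r, s.+2))
    = INR (kcount e 2) * INR n ^ s * INR 'C(r, s.+2) * INR r ^ 2 by ring.
  apply: Rle_trans (Rmult_le_compat_r _ _ _ (Rlt_le _ _ (r0 2%N)) K).
  have -> : INR (kcount e s.+2) * INR r ^ s * INR 'C(r, 2) * INR r ^ 2
    = INR (kcount e s.+2) * (INR r ^ s.+2 * INR 'C(r, 2)).
    by rewrite /=; ring.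
  have P : 0 <= INR r ^ s.+2 * INR 'C(r, 2).
    by apply: Rmult_le_pos; [exact: Rlt_le|exact: pos_INR].
  apply: Rle_trans (Rmult_le_compat_r _ _ _ P Hs); apply: Req_le.
  rewrite Rdiv_def Rpow_mult_distr pow_inv /y.
  have -> : INR n ^ s.+2 = INR n ^ s * INR n ^ 2 by rewrite /=; ring.
  by field; have := r0 s.+2; lra.
set P := Rpower _ _ in yle *.
apply: (Rmult_le_reg_r (INR r ^ 2)) => //.
have := n0' 2%N.
have -> : ((1 - / INR r) * INR n ^ 2 - 2 * (INR 'C(r, 2) * P) * INR n ^ 2) * INR r ^ 2
  = (INR r * (INR r - 1)) * INR n ^ 2 - 2 * INR 'C(r, 2) * INR n ^ 2 * (P * INR r ^ 2).
  by field; lra.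
move=> n2; have : 2 * INR 'C(r, 2) * INR n ^ 2 * y
                  <= 2 * INR 'C(r, 2) * INR n ^ 2 * (P * INR r ^ 2).
  by apply: Rmult_le_compat_l => //; apply: Rmult_le_pos; [rewrite D2; nra|lra].
by rewrite -D2; nra.
Qed.

Theorem theorem3p6 (r s : nat) (hr : (2 <= r)%N) (hs1 : (2 <= s)%N) (hs2 : (s <= r)%N) :
  exists eps : R -> R,
    (forall eta : R, 0 < eta ->
       exists th : R, 0 < th /\ forall d : R, 0 < d < th -> Rabs (eps d) < eta) /\
    exists d0 : R, 0 < d0 /\
    exists n0 : nat,
      forall (n : nat) (d : R), (n0 <= n)%N -> 0 < d <= d0 ->
      forall e : rel 'I_n, is_graph e ->
        kcount e r.+1 = 0%N ->
        INR (kcount e s) >= INR 'C(r, s) * (INR n / INR r) ^ s - d * INR n ^ s ->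
        INR (Dr r e) <=
          (2 * INR r / (3 * sqrt 3) + eps d)
          * Rpower (INR 'C(r, 2)) (3 / 2) / Rpower (INR 'C(r, s)) (3 / INR s)
          * Rpower d (3 / INR s) * INR n ^ 2.
Proof.
set C2 := INR 'C(r, 2); set Cs := INR 'C(r, s).
have C20 : 0 < C2 by apply: lt_0_INR; apply/ltP; rewrite bin_gt0.
have Cs0 : 0 < Cs by apply: lt_0_INR; apply/ltP; rewrite bin_gt0.
have R2 : 2 <= INR r by have := INR_leq hr; rewrite INR_2.
have S2 : 2 <= INR s by have := INR_leq hs1; rewrite INR_2.
have r0 k : 0 < INR r ^ k by apply: pow_lt; lra.
have p0 : 0 < 1 / (4 * INR s) by apply: Rdiv_lt_0_compat; lra.
(* Chosen so that [bt d ^ 8] is [alpha] and [bt d ^ 12] is [alpha^(3/2)], the order of the claimed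
   bound. *)
pose bt d := Rpower C2 (1 / 8) * Rpower (d / Cs) (1 / (4 * INR s)).
have bt0 d : 0 < bt d by apply: Rmult_lt_0_compat; exact: exp_pos.
have bt_small eta : 0 < eta -> exists th, 0 < th /\ forall d, 0 < d < th -> bt d < eta.
  move=> eta0; have [th [th0 H]] := Rpower_small (exp_pos (1 / 8 * ln C2)) p0 eta0.
  exists (th * Cs); split=> [|d dth]; first exact: Rmult_lt_0_compat.
  apply: H; split; first by apply: Rdiv_lt_0_compat; lra.
  apply: (Rmult_lt_reg_r Cs) => //.
  have -> : d / Cs * Cs = d by field; lra.
  by lra.
exists (fun d => 264 * INR r ^ 3 * bt d); split=> [eta eta0|].
  have c0 : 0 < 264 * INR r ^ 3 by have := r0 3%N; lra.
  have [th [th0 H]] := bt_small (eta / (264 * INR r ^ 3)) (Rdiv_lt_0_compat _ _ eta0 c0).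
  exists th; split=> // d /H Hd; rewrite Rabs_pos_eq; last first.
    by apply: Rlt_le; apply: Rmult_lt_0_compat.
  apply: Rlt_le_trans (Rmult_lt_compat_l _ _ _ c0 Hd) _.
  by apply: Req_le; field; lra.
have [th [th0 Hth]] : exists th, 0 < th /\ forall d, 0 < d < th -> bt d < / (10 * INR r).
  by apply: bt_small; apply: Rinv_0_lt_compat; lra.
(* The first entry keeps [d] strictly below [th], hence [10 r bt <= 1]; the second gives
   [z r^s <= 1] for [edges_of_cliques]. *)
exists (Rmin (th / 2) (Cs / INR r ^ s)); split.
  by apply: Rmin_pos; [lra|exact: Rdiv_lt_0_compat].
exists 1%N => n d n1 [d0 dle] e ge nK ks.
have dth := Rle_trans _ _ _ dle (Rmin_l _ _).
have dCs := Rle_trans _ _ _ dle (Rmin_r _ _).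
have z0 : 0 < d / Cs by exact: Rdiv_lt_0_compat.
have z1 : d / Cs * INR r ^ s <= 1.
  have := Rmult_le_compat_r _ _ _ (Rlt_le _ _ (r0 s)) dCs.
  have -> : Cs / INR r ^ s * INR r ^ s = Cs by field; have := r0 s; lra.
  move=> H; apply: (Rmult_le_reg_r Cs) => //.
  have -> : d / Cs * INR r ^ s * Cs = d * INR r ^ s by field; lra.
  by lra.
have b8 : bt d ^ 8 = C2 * Rpower (d / Cs) (2 / INR s).
  rewrite /bt Rpow_mult_distr !Rpower_exp_pow -{2}(Rpower_1 C2) // (INR_IZR_INZ 8).
  by congr (Rpower _ _ * Rpower _ _); rewrite /=; field; lra.
have b12 : bt d ^ 12 = Rpower C2 (3 / 2) / Rpower Cs (3 / INR s) * Rpower d (3 / INR s).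
  have -> : Rpower d (3 / INR s) = Rpower (d / Cs) (3 / INR s) * Rpower Cs (3 / INR s).
    by rewrite Rpower_mult_distr //; congr Rpower; field; lra.
  have := exp_pos (3 / INR s * ln Cs); rewrite -/(Rpower Cs (3 / INR s)) => X0.
  transitivity (Rpower C2 (3 / 2) * Rpower (d / Cs) (3 / INR s)); last by field; lra.
  rewrite /bt Rpow_mult_distr !Rpower_exp_pow (INR_IZR_INZ 12).
  by congr (Rpower _ _ * Rpower _ _); rewrite /=; field; lra.
have br : bt d * (10 * INR r) <= 1.
  have H : bt d < / (10 * INR r) by apply: Hth; lra.
  have -> : 1 = / (10 * INR r) * (10 * INR r) by field; lra.
  by apply: Rmult_le_compat_r; lra.
apply: Rle_trans (edge_stability ge hr nK (bt0 d) br _) _.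
  rewrite b8; apply: edges_of_cliques hs2 n1 nK z0 z1 _ => //.
  have -> : d / Cs * Cs = d by field; lra.
  exact: Rge_le ks.
by apply: Req_le; rewrite b12; rewrite /Rdiv; ring.
Qed.
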